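(* Let $G$ be a finite abelian group, $A=\mathrm{Hom}(G,\Bbbk^\times)$, and $\beta$ a bicharacter on $G$. Let $\Gamma$ be a finite group provided with an action of $A$ by group automorphisms, and consider the induced $G$-gradings on $\Bbbk\Gamma$ and on its dual $\Bbbk^\Gamma$. Then the following are equivalent: (i) $\Bbbk\Gamma$ is a $(G,\beta)$-color Hopf algebra; (ii) $\beta(g,h)=1$ for all $g,h\in\sup\Bbbk\Gamma$; (iii) $\Gamma$ is a $(G,\beta)$-color group; (iv) $\Bbbk^\Gamma$ is a $(G,\beta)$-color Hopf algebra.
   Context: $\Bbbk$ is an algebraically closed field of characteristic $0$. A bicharacter is a map $\beta:G\times G\to\Bbbk^\times$ multiplicative in each variable; $\chi:G\to A$ is the homomorphism $\chi_g(h)=\beta(h,g)$. A $(G,\beta)$-color Hopf algebra is a Hopf algebra in the braided category of $G$-graded vector spaces with braiding $c(v\otimes w)=\beta(|v|,|w|)w\otimes v$ for homogeneous $v,w$ of degrees $|v|,|w|$ (antipode bijective). In (i) and (iv), $\Bbbk\Gamma$ and $\Bbbk^\Gamma=(\Bbbk\Gamma)^*$ carry their usual multiplication and comultiplication. The action of $A$ on $\Gamma$ extends linearly to $\Bbbk\Gamma$ and gives the $G$-grading $(\Bbbk\Gamma)_g=\{x: a\cdot x=a(g)x\ \forall a\in A\}$. The dual $V^*$ of a finite-dimensional graded space $V$ is graded by $(V^* )_g=\mathrm{Hom}(V_{g^{-1}},\Bbbk)$. The support of a graded space $V$ is $\sup V=\{g\in G:V_g\ne0\}$. $G$ acts on $\Gamma$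 via $\chi$; for $\eta\in\Gamma$, $G^\eta=\{g\in G:\chi_g\cdot\eta=\eta\}$ is the isotropy subgroup. $\mathrm{Stab}_A(\Gamma)=\{a\in A:a\cdot\eta=\eta\ \forall\eta\in\Gamma\}$. For a subgroup $L\le G$, $L^\perp=\{a\in A:a|_L=1\}$. A $(G,\beta)$-color group is a group $\Gamma$ with an action of $A$ by group automorphisms such that $(G^\eta)^\perp\subseteq\mathrm{Stab}_A(\Gamma)$ for all $\eta\in\Gamma$. *)

(* Defs.v *)
From HB Require Import structures.
From mathcomp Require Import all_boot all_fingroup all_algebra all_solvable.

Set Implicit Arguments.
Unset Strict Implicit.
Unset Printing Implicit Defensive.

Import GRing.Theory.
Local Open Scope ring_scope.

Section CharGroup.
Variables (k : closedFieldType) (G : finGroupType).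

Definition is_char (f : {ffun G -> k}) :=
  [forall g, f g != 0] && [forall g, forall h, f (g * h)%g == f g * f h].

Record char_group := CharGroup { char_fun :> {ffun G -> k}; _ : is_char char_fun }.

HB.instance Definition _ := [isSub for char_fun].
HB.instance Definition _ := [Choice of char_group by <:].

Lemma char_neq0 (a : char_group) g : a g != 0.
Proof. by case/andP: (valP a) => /forallP. Qed.

Lemma charM (a : char_group) g h : a (g * h)%g = a g * a h.
Proof. by case/andP: (valP a) => _ /forallP/(_ g)/forallP/(_ h)/eqP. Qed.

Lemma char1 (a : char_group) : a 1%g = 1.
Proof. by apply: (mulfI (char_neq0 a 1%g)); rewrite -charM mul1g mulr1. Qed.

Lemma charX (a : char_group) g n : a (g ^+ n)%g = a g ^+ n.
Proof.
elim: n => [|n IHn]; first by rewrite expg0 expr0 char1.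
by rewrite expgS exprS charM IHn.
Qed.

(* Finiteness: characters take values in the roots of 'X^#|G| - 1. *)
Let unity_roots : seq k :=
  sval (closed_field_poly_normal ('X^#|G| - 1 : {poly k})).

Let char_in_roots (a : char_group) g : a g \in unity_roots.
Proof.
rewrite /unity_roots; case: (closed_field_poly_normal _) => r /= Hr.
have p0 : ('X^#|G| - 1 : {poly k}) != 0.
  by rewrite -size_poly_eq0 size_XnsubC ?cardG_gt0 // -cardsT cardG_gt0.
have: root ('X^#|G| - 1) (a g).
  rewrite rootE !hornerE -charX.
  by rewrite -cardsT expg_cardG ?inE // char1 subrr.
by rewrite {1}Hr rootZ ?lead_coef_eq0 // root_prod_XsubC.
Qed.

Let char_code (a : char_group) : {ffun G -> seq_sub unity_roots} :=
  [ffun g => SeqSub (char_in_roots a g)].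

Let char_decode (c : {ffun G -> seq_sub unity_roots}) : option char_group :=
  insub [ffun g => ssval (c g)].

Let char_codeK : pcancel char_code char_decode.
Proof.
move=> a; rewrite /char_decode.
have -> : [ffun g => ssval (char_code a g)] = val a.
  by apply/ffunP => g; rewrite !ffunE.
exact: valK.
Qed.

HB.instance Definition _ := PCanIsCountable char_codeK.
HB.instance Definition _ : isFinite char_group := PCanIsFinite char_codeK.

Lemma char_groupP (f : G -> k) :
    (forall g, f g != 0) -> (forall g h, f (g * h)%g = f g * f h) ->
  is_char (finfun f).
Proof.
move=> f0 fM; apply/andP; split; apply/forallP => g; first by rewrite ffunE.
by apply/forallP => h; rewrite !ffunE fM.
Qed.

Fact char_one_subproof : is_char [ffun=> 1].
Proof. by apply: char_groupP => *; rewrite ?oner_eq0 ?mulr1. Qed.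
Definition char_one := CharGroup char_one_subproof.

Fact char_mul_subproof (a b : char_group) : is_char [ffun g => a g * b g].
Proof.
by apply: char_groupP => *; rewrite ?mulf_neq0 ?char_neq0 // !charM mulrACA.
Qed.
Definition char_mul a b := CharGroup (char_mul_subproof a b).

Fact char_inv_subproof (a : char_group) : is_char [ffun g => (a g)^-1].
Proof.
by apply: char_groupP => *; rewrite ?invr_neq0 ?char_neq0 // charM invfM.
Qed.
Definition char_inv a := CharGroup (char_inv_subproof a).

Fact char_mulA : associative char_mul.
Proof. by move=> a b c; apply/val_inj/ffunP => g; rewrite !ffunE mulrA. Qed.
Fact char_mul1 : left_id char_one char_mul.
Proof. by move=> a; apply/val_inj/ffunP => g; rewrite !ffunE mul1r. Qed.
Fact char_mulV : left_inverse char_one char_inv char_mul.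
Proof.
by move=> a; apply/val_inj/ffunP => g; rewrite !ffunE mulVf ?char_neq0.
Qed.

HB.instance Definition _ :=
  Finite_isGroup.Build char_group char_mulA char_mul1 char_mulV.

End CharGroup.

Definition perp (k : closedFieldType) (G : finGroupType) (L : {set G}) :
    {set char_group k G} :=
  [set a : char_group k G | [forall g in L, a g == 1]].

Record bicharacter (k : closedFieldType) (G : finGroupType) := Bicharacter {
  bichar_fun :> G -> G -> k;
  bichar_neq0 : forall g h, bichar_fun g h != 0;
  bicharMl : forall g g' h,
    bichar_fun (g * g')%g h = bichar_fun g h * bichar_fun g' h;
  bicharMr : forall g h h',
    bichar_fun g (h * h')%g = bichar_fun g h * bichar_fun g h' }.

Section Chi.
Variables (k : closedFieldType) (G : finGroupType) (beta : bicharacter k G).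

Fact chi_subproof (g : G) : is_char [ffun h => beta h g].
Proof. by apply: char_groupP => *; rewrite ?bichar_neq0 ?bicharMl. Qed.

Definition chi (g : G) : char_group k G := CharGroup (chi_subproof g).

End Chi.

Section ColorGroup.
Variables (k : closedFieldType) (G Gamma : finGroupType).
Variable beta : bicharacter k G.
(* Library actions are right actions; as Hom(G, k^x) is commutative, left and
   right actions of it coincide. *)
Variable to : groupAction [set: char_group k G] [set: Gamma].

Definition isotropy (eta : Gamma) : {set G} := [set g | to eta (chi beta g) == eta].

Definition color_group :=
  forall eta : Gamma, perp k (isotropy eta) \subset 'C([set: Gamma] | to)%g.

End ColorGroup.

Section Tensor.
Variable k : fieldType.
Implicit Types V W U : vectType k.

(* A tensor is given by its coordinates in the basis of the e_i (x) f_j, where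
   (e_i) and (f_j) are the bases of V and W chosen by the library. *)
Definition tensor V W : vectType k := 'M[k]_(\dim {:V}, \dim {:W}).

Definition tens V W (v : V) (w : W) : tensor V W :=
  \matrix_(i, j) (coord (vbasis {:V}) i v * coord (vbasis {:W}) j w).

(* The linear map on [tensor V W] induced by a bilinear map [f]. *)
Definition tens_lift V W U (f : V -> W -> U) : 'Hom(tensor V W, U) :=
  linfun (fun t : tensor V W =>
    \sum_i \sum_j t i j *: f (vbasis {:V})`_i (vbasis {:W})`_j).

Lemma tens_liftE V W U (f : V -> W -> U) v w :
    (forall w, linear (f^~ w)) -> (forall v, linear (f v)) ->
  tens_lift f (tens v w) = f v w.
Proof.
move=> fl fr; rewrite /tens_lift.
set F := fun t => _.
have FL : linear F.
  move=> a s t; rewrite /F scaler_sumr -big_split; apply: eq_bigr => i _ /=.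
  rewrite scaler_sumr -big_split; apply: eq_bigr => j _ /=.
  by rewrite !mxE scalerDl scalerA.
pose F' := GRing.isLinear.Build _ _ _ _ F FL.
pose Flin : {linear tensor V W -> U} := HB.pack F F'.
rewrite -[linfun F]/(linfun Flin) lfunE /= /F.
rewrite [in RHS](coord_vbasis (memvf v)) [in RHS](coord_vbasis (memvf w)).
pose fL y := HB.pack_for {linear V -> U} (f^~ y)
  (GRing.isLinear.Build _ _ _ _ (f^~ y) (fl y)).
pose fR x := HB.pack_for {linear W -> U} (f x)
  (GRing.isLinear.Build _ _ _ _ (f x) (fr x)).
rewrite -[RHS]/(fL _ _) linear_sum; apply: eq_bigr => i _.
rewrite linearZ /= -[f _ _]/(fR _ _) linear_sum scaler_sumr.
by apply: eq_bigr => j _; rewrite linearZ /= mxE scalerA.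
Qed.

Definition tens_map V W V' W' (f : 'Hom(V, V')) (g : 'Hom(W, W')) :
    'Hom(tensor V W, tensor V' W') :=
  tens_lift (fun v w => tens (f v) (g w)).

Definition tens_assoc V W U :
    'Hom(tensor (tensor V W) U, tensor V (tensor W U)) :=
  tens_lift (fun t u => tens_lift (fun v w => tens v (tens w u)) t).

End Tensor.

Section Graded.
Variables (k : fieldType) (G : finGroupType).
Implicit Types V W : vectType k.

Definition is_grading V (gr : G -> {vspace V}) :=
  directv (\sum_g gr g)%VS && ((\sum_g gr g)%VS == fullv).

(* The projection onto [gr g] along the other components; meaningful when
   [is_grading gr] holds. *)
Definition homogeneous_comp V (gr : G -> {vspace V}) (g : G) : 'End(V) :=
  sumv_pi (\sum_h gr h)%VS g.

Definition support_gr V (gr : G -> {vspace V}) : {set G} :=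
  [set g | gr g != 0%VS].

Definition tens_grading V W (grV : G -> {vspace V}) (grW : G -> {vspace W})
    (g : G) : {vspace tensor V W} :=
  (\sum_h <<[seq tens v w | v <- vbasis (grV h), w <- vbasis (grW (h^-1 * g)%g)]>>)%VS.

(* The grading of the unit object k, concentrated in degree 1. *)
Definition triv_grading (g : G) : {vspace k^o} :=
  if g == 1%g then fullv else 0%VS.

Definition graded_map V W (grV : G -> {vspace V}) (grW : G -> {vspace W})
    (f : 'Hom(V, W)) :=
  forall g, (f @: grV g <= grW g)%VS.

Definition dual V : vectType k := 'Hom(V, k^o).

(* (V^* )_g consists of the linear forms vanishing on V_h for all h != g^-1. *)
Definition dual_grading V (gr : G -> {vspace V}) (g : G) : {vspace dual V} :=
  (\bigcap_(h | h != g^-1%g)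
     lker (linfun (fun f : dual V => (f \o projv (gr h))%VF : dual V)))%VS.

End Graded.

Section ColorHopf.
Variables (k : closedFieldType) (G : finGroupType) (beta : bicharacter k G).

Definition braiding (V W : vectType k)
    (grV : G -> {vspace V}) (grW : G -> {vspace W}) :
    'Hom(tensor V W, tensor W V) :=
  tens_lift (fun v w => \sum_g \sum_h
    beta g h *: tens (homogeneous_comp grW h w) (homogeneous_comp grV g v)).

Variables (H : vectType k) (gr : G -> {vspace H}).

(* The map id (x) c (x) id on (H (x) H) (x) (H (x) H), c being the braiding. *)
Definition middle_braiding :
    'End(tensor (tensor H H) (tensor H H)) :=
  tens_lift (fun s t =>
    tens_lift (fun a b =>
      tens_lift (fun c d =>
        tens_lift (fun c' b' => tens (tens a c') (tens b' d))
          (braiding gr gr (tens b c))) t) s).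

Variables (mul : 'Hom(tensor H H, H)) (one : H).
Variables (comul : 'Hom(H, tensor H H)) (counit : 'Hom(H, k^o)).

(* An algebra in graded spaces: the unit map k -> H is represented by the image
   [one] of 1, so it preserves degrees iff [one] has degree 1. *)
Record is_graded_algebra : Prop := {
  mul_graded : graded_map (tens_grading gr gr) gr mul;
  one_graded : one \in gr 1%g;
  mul_assoc : forall x y z,
    mul (tens (mul (tens x y)) z) = mul (tens x (mul (tens y z)));
  mul_onel : forall x, mul (tens one x) = x;
  mul_oner : forall x, mul (tens x one) = x }.

Record is_graded_coalgebra : Prop := {
  comul_graded : graded_map gr (tens_grading gr gr) comul;
  counit_graded : graded_map gr (@triv_grading k G) counit;
  comul_coassoc :
    (tens_assoc H H H \o (tens_map comul \1 \o comul))%VF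
    = (tens_map \1 comul \o comul)%VF;
  comul_counitl : forall x, tens_lift (fun a b => counit a *: b) (comul x) = x;
  comul_counitr : forall x, tens_lift (fun a b => counit b *: a) (comul x) = x }.

Record is_color_bialgebra : Prop := {
  color_grading : is_grading gr;
  color_algebra : is_graded_algebra;
  color_coalgebra : is_graded_coalgebra;
  comul_mul :
    (comul \o mul)%VF
    = (tens_map mul mul \o (middle_braiding \o tens_map comul comul))%VF;
  comul_one : comul one = tens one one;
  counit_mul : forall x y, counit (mul (tens x y)) = counit x * counit y;
  counit_one : counit one = 1 }.

Record is_color_antipode (S : 'End(H)) : Prop := {
  antipode_graded : graded_map gr gr S;
  antipode_bij : bijective S;
  antipodel : forall x, mul (tens_map S \1 (comul x)) = counit x *: one;
  antipoder : forall x, mul (tens_map \1 S (comul x)) = counit x *: one }.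

Definition is_color_Hopf_algebra : Prop :=
  is_color_bialgebra /\ exists S, is_color_antipode S.

End ColorHopf.

Section GroupAlgebra.
Variables (k : closedFieldType) (Gamma : finGroupType).

Definition group_alg : vectType k := {ffun Gamma -> k^o}.

Definition ga_elt (s : Gamma) : group_alg := [ffun t => (s == t)%:R].

Definition ga_mul : 'Hom(tensor group_alg group_alg, group_alg) :=
  tens_lift (fun x y : group_alg =>
    \sum_s \sum_t (x s * y t) *: ga_elt (s * t)%g).

Definition ga_comul : 'Hom(group_alg, tensor group_alg group_alg) :=
  linfun (fun x : group_alg => \sum_s x s *: tens (ga_elt s) (ga_elt s)).

Definition ga_counit : 'Hom(group_alg, k^o) :=
  linfun (fun x : group_alg => \sum_s x s).

(* The dual basis: [ga_delta s] is the coordinate form x |-> x s. *)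
Definition ga_delta (s : Gamma) : dual group_alg :=
  linfun (fun x : group_alg => x s).

(* The product of two functions on Gamma is pointwise. *)
Definition gf_mul :
    'Hom(tensor (dual group_alg) (dual group_alg), dual group_alg) :=
  tens_lift (fun f h : dual group_alg =>
    \sum_s (f (ga_elt s) * h (ga_elt s)) *: ga_delta s).

Definition gf_one : dual group_alg := \sum_s ga_delta s.

(* comul(f) is the function (s, t) |-> f(s t) on Gamma x Gamma. *)
Definition gf_comul :
    'Hom(dual group_alg, tensor (dual group_alg) (dual group_alg)) :=
  linfun (fun f : dual group_alg =>
    \sum_s \sum_t f (ga_elt (s * t)%g) *: tens (ga_delta s) (ga_delta t)).

Definition gf_counit : 'Hom(dual group_alg, k^o) :=
  linfun (fun f : dual group_alg => f (ga_elt 1%g)).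

Variable G : finGroupType.
Variable to : groupAction [set: char_group k G] [set: Gamma].

Definition ga_act (a : char_group k G) : 'End(group_alg) :=
  linfun (fun x : group_alg => \sum_s x s *: ga_elt (to s a)).

Definition ga_grading (g : G) : {vspace group_alg} :=
  (\bigcap_(a : char_group k G) passmx.leigenspace (ga_act a) (a g))%VS.

End GroupAlgebra.

(* Main.v *)
(* By averaging against characters, the action of [A] on [kGamma] and the
   contragredient action on its dual are diagonalized by the gradings, so that
   every [A]-equivariant map preserves degrees. All structure maps are
   equivariant, hence both sides are ordinary Hopf algebras in graded spaces,
   and the only axiom in question is the compatibility of the product and the
   coproduct through the braiding [c].
   - In [kGamma], this axiom on [s (x) t], multiplied by [s^-1] on the left and
     by [t^-1] on the right, says that [c (s (x) t) = t (x) s].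
   - In the dual, evaluating it for [delta_(xv)] and [delta_(uy)] at [(x, y)]
     says that [c (delta_v (x) delta_u)] and [delta_u (x) delta_v] agree at
     [(x, y)].
   So in both cases it holds iff [c] is the flip, that is, iff [beta = 1] on
   the support; the support of the dual is the inverse of that of [kGamma].
   Finally [a] fixes [Gamma] iff [a = 1] on the support; thus (ii) says that
   every [chi_g] with [g] in the support fixes [Gamma], and the equivalence with
   (iii) follows as the characters of [G] trivial on a subgroup [L] separate
   [L] from the elements outside it. *)
From HB Require Import structures.
Require Import Defs.
From mathcomp Require Import all_boot all_fingroup all_algebra all_solvable.
From mathcomp Require Import mxrepresentation.
(* [Defs.charM] would otherwise be shadowed by its homonym on characteristic
   subgroups. *)
Import Defs.

Set Implicit Arguments.
Unset Strict Implicit.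
Unset Printing Implicit Defensive.

Import GroupScope GRing.Theory.
Local Open Scope ring_scope.

(** * Characters of a finite abelian group: separation and orthogonality *)

Section Characters.
Variables (k : closedFieldType) (char0 : [pchar k] =i pred0).

Lemma natr_card_neq0 (T : finType) : (0 < #|T|)%N -> #|T|%:R != 0 :> k.
Proof. by rewrite ((pcharf0P k).1 char0) lt0n. Qed.

(* A nontrivial [y] moves some simple submodule of the regular representation,
   and that submodule is one-dimensional. *)
Lemma abelian_char_neq1 (Q : finGroupType) (y : Q) :
    abelian [set: Q] -> y != 1%g ->
  [exists a : char_group k Q, a y != 1].
Proof.
move=> cQQ y1; set aQ := regular_repr k [set: Q]%G.
have F'Q : [pchar k]^'.-group [set: Q].
  by rewrite /pgroup pcharf'_nat cardsT natr_card_neq0 // -cardsT cardG_gt0.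
apply: (mx_reducible_semisimple (mxmodule1 aQ) (mx_Maschke_pchar aQ F'Q)).
case=> I U W simU defW _.
(* An element acting as the identity on every simple summand lies in the kernel of the regular
   representation, which is faithful. *)
have [i yUi] : exists i, U i *m aQ y != U i.
  apply/existsP; apply: contraR y1; rewrite negb_exists => /forallP fixU.
  have := subsetP (regular_mx_faithful k [set: Q]%G) y.
  rewrite in_set1; apply; rewrite /rker -(eqmx_rstab _ defW) inE in_setT /=.
  have [u ->] : exists u : I -> 'M_ _, W = \sum_i u i *m U i.
    by have /sub_sumsmxP[u] := submx_refl W; exists u.
  rewrite mulmx_suml; apply/eqP/eq_bigr => i _; rewrite -mulmxA.
  by have := fixU i; rewrite negbK => /eqP->.
have [modU nzU _] := simU i.
have rU := mxsimple_abelian_linear (@group_closure_closed_field k Q _) cQQ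
  (simU i).
set u := nz_row (U i).
have nzu : u != 0 by rewrite nz_row_eq0.
have Uu : (U i <= u)%MS.
  by rewrite -(geq_leqif (mxrank_leqif_sup (nz_row_sub (U i)))) rU lt0n mxrank_eq0.
have [j uj] : exists j, u 0 j != 0.
  by apply/rV0Pn.
(* [u] spans the line [U i], so it is an eigenvector of every [aQ x]; the eigenvalue is read off at
   a nonzero coordinate of [u]. *)
pose c x := (u *m aQ x) 0 j / u 0 j.
have cP x : u *m aQ x = c x *: u.
  have /sub_rVP[d ud] : (u *m aQ x <= u)%MS.
    apply: submx_trans Uu; apply: submx_trans (mxmoduleP modU x (in_setT _)).
    exact/submxMr/nz_row_sub.
  by rewrite /c ud mxE mulfK.
have c_inj d e : d *: u = e *: u -> d = e.
  by move/(congr1 (fun v : 'rV__ => v 0 j)); rewrite !mxE => /(mulIf uj).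
have cM x z : c (x * z)%g = c x * c z.
  apply: c_inj; rewrite -cP repr_mxM ?in_setT // mulmxA cP -scalemxAl cP.
  by rewrite scalerA.
have c1 : c 1%g = 1 by apply: c_inj; rewrite -cP repr_mx1 mulmx1 scale1r.
have c0 x : c x != 0.
  by apply: contraTneq (oner_neq0 k) => cx; rewrite -c1 -(mulgV x) cM cx mul0r eqxx.
apply/existsP; exists (CharGroup (char_groupP c0 cM)); rewrite /= ffunE.
apply: contraNneq yUi => cy; have /submxP[v ->] := Uu.
by rewrite -mulmxA cP cy scale1r.
Qed.

Variables (G : finGroupType) (abelG : abelian [set: G]).

(** A character of the quotient by [L] that is nontrivial on the coset of [h] pulls back to [G]. *)
Lemma char_separates (L : {group G}) (h : G) :
  h \notin L -> exists2 a : char_group k G, a \in perp k L & a h != 1.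
Proof.
move=> hL.
have nL x : x \in 'N(L) by rewrite (subsetP (sub_abelian_norm abelG (subsetT L))).
have cLL : abelian [set: coset_of L].
  by rewrite -[[set: _]]quotientT quotient_abelian.
have /(abelian_char_neq1 cLL)/existsP[b bh] : coset L h != 1%g.
  by apply: contra hL => /eqP/coset_idr->.
have bM x z : b (coset L (x * z)%g) = b (coset L x) * b (coset L z).
  by rewrite morphM // charM.
exists (CharGroup (char_groupP (fun x => char_neq0 b (coset L x)) bM)).
  rewrite inE; apply/forall_inP => x Lx /=.
  by rewrite ffunE coset_id // char1.
by rewrite /= ffunE.
Qed.

Lemma char_separates1 (h : G) : h != 1%g -> exists a : char_group k G, a h != 1.
Proof.
by rewrite -in_set1 => /(@char_separates 1%G)[a _ ah]; exists a.
Qed.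

Lemma char_inj g h : (forall a : char_group k G, a g = a h) -> g = h.
Proof.
move=> eq_gh; apply/eqP; rewrite eq_mulgV1; apply: contraT => /char_separates1.
by case=> a; rewrite charM eq_gh -charM mulgV char1 eqxx.
Qed.

Lemma char_charM (a b : char_group k G) g : (a * b)%g g = a g * b g.
Proof. by rewrite /= ffunE. Qed.

Lemma charV (a : char_group k G) g : a g^-1%g = (a g)^-1.
Proof.
apply: (mulfI (char_neq0 a g)).
by rewrite -charM mulgV char1 divff ?char_neq0.
Qed.

Lemma char_charV (a : char_group k G) g : a^-1%g g = (a g)^-1.
Proof. by rewrite /= ffunE. Qed.

Lemma char_char1 g : (1%g : char_group k G) g = 1.
Proof. by rewrite /= ffunE. Qed.

Lemma char_mulC (a b : char_group k G) : (a * b = b * a)%g.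
Proof. by apply/val_inj/ffunP => g; rewrite !ffunE mulrC. Qed.

(** Multiplication by a character [b] with [b g != 1] permutes the characters, yet scales the sum by
    [b g]. *)
Lemma sum_char_eq0 g :
  g != 1%g -> \sum_(a : char_group k G) a g = 0.
Proof.
move=> /char_separates1[b bg]; apply/eqP.
have : (b g - 1) * (\sum_(a : char_group k G) a g) == 0.
  rewrite mulrBl mul1r subr_eq0 mulr_sumr; apply/eqP.
  rewrite [RHS](reindex_inj (mulgI b)); apply: eq_bigr => a _.
  by rewrite char_charM.
by rewrite mulf_eq0 subr_eq0 (negPf bg).
Qed.

(** The dual relation: translation by an [h] with [a h != 1] permutes [G], yet scales the sum by
    [a h]. *)
Lemma sum_group_char_eq0 (a : char_group k G) :
  a != 1%g -> \sum_g a g = 0.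
Proof.
move=> a1; have [h ah] : exists h, a h != 1.
  apply/existsP; apply: contraR a1; rewrite negb_exists => /forallP a1.
  apply/eqP/val_inj/ffunP => h.
  by have := a1 h; rewrite negbK => /eqP; rewrite /= ffunE.
have : (a h - 1) * (\sum_g a g) == 0.
  rewrite mulrBl mul1r subr_eq0 mulr_sumr; apply/eqP.
  rewrite [RHS](reindex_inj (mulgI h)); apply: eq_bigr => g _.
  by rewrite charM.
by rewrite mulf_eq0 subr_eq0 (negPf ah) => /eqP.
Qed.

End Characters.

(** * Linear maps and predicates tested on a spanning family *)

Definition spanned (k : fieldType) (V : vectType k) (I : finType) (e : I -> V) :=
  forall v, exists c : I -> k, v = \sum_i c i *: e i.

Section Spanned.
Variables (k : fieldType) (V W : vectType k) (I : finType) (e : I -> V).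
Hypothesis spe : spanned e.

(** Reduces an identity that is linear in [v] to the spanning vectors; multilinear identities are
    treated one variable at a time. *)
Lemma spanned_ind (P : V -> Prop) :
    (forall a u v, P u -> P v -> P (a *: u + v)) -> P 0 -> (forall i, P (e i)) ->
  forall v, P v.
Proof.
move=> PD P0 Pe v; have [c ->] := spe v; elim/big_rec: _ => // i u _ Pu.
exact: PD.
Qed.

Lemma eq_lfun_spanned (f g : 'Hom(V, W)) :
  (forall i, f (e i) = g (e i)) -> f = g.
Proof.
move=> eq_fg; apply/lfunP => v; have [c ->] := spe v.
by rewrite !linear_sum; apply: eq_bigr => i _; rewrite !linearZ /= eq_fg.
Qed.

End Spanned.

Lemma linfunE (k : fieldType) (V W : vectType k) (f : V -> W) :
  linear f -> linfun f =1 f.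
Proof.
move=> lf v; pose f' := HB.pack_for {linear V -> W} f
  (GRing.isLinear.Build _ _ _ _ f lf).
by rewrite -[linfun f]/(linfun f') lfunE.
Qed.

(** * Calculus of pure tensors and of maps out of tensor products *)

Section Tensors.
Variable k : fieldType.
Implicit Types V W U : vectType k.

Lemma tensPl V W a (u v : V) (w : W) :
  tens (a *: u + v) w = a *: tens u w + tens v w.
Proof.
apply/matrixP => i j.
by rewrite !mxE linearP /= mulrDl mulrA.
Qed.

Lemma tensPr V W a (v : V) (u w : W) :
  tens v (a *: u + w) = a *: tens v u + tens v w.
Proof.
apply/matrixP => i j.
by rewrite !mxE linearP /= mulrDr mulrCA.
Qed.

(** Names the map in the first argument, so that it can carry a structure of linear map. *)
Definition tens_flip V W (w : W) (v : V) := tens v w.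

HB.instance Definition _ V W (w : W) :=
  GRing.isLinear.Build k V (tensor V W) _ (@tens_flip V W w)
    (fun a u v => tensPl a u v w).
HB.instance Definition _ V W (v : V) :=
  GRing.isLinear.Build k W (tensor V W) _ (tens v)
    (fun a u w => tensPr a v u w).

Lemma tens0l V W (w : W) : tens (0 : V) w = 0.
Proof. exact: linear0 (@tens_flip V W w). Qed.
Lemma tens0r V W (v : V) : tens v (0 : W) = 0.
Proof. exact: linear0. Qed.
Lemma tensZl V W a (v : V) (w : W) : tens (a *: v) w = a *: tens v w.
Proof. exact: linearZ_LR (@tens_flip V W w) a v. Qed.
Lemma tensZr V W a (v : V) (w : W) : tens v (a *: w) = a *: tens v w.
Proof. exact: linearZ_LR. Qed.
Lemma tens_suml V W (I : finType) (P : pred I) (F : I -> V) (w : W) :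
  tens (\sum_(i | P i) F i) w = \sum_(i | P i) tens (F i) w.
Proof. exact: (linear_sum (@tens_flip V W w)). Qed.
Lemma tens_sumr V W (I : finType) (P : pred I) (v : V) (F : I -> W) :
  tens v (\sum_(i | P i) F i) = \sum_(i | P i) tens v (F i).
Proof. exact: linear_sum. Qed.

(** Nonzero vectors have nonzero coordinates at some [i] and [j], whose product is the entry of the
    tensor at [i], [j]. *)
Lemma tens_eq0 V W (v : V) (w : W) :
  (tens v w == 0) = (v == 0) || (w == 0).
Proof.
have coord0 U (u : U) : u != 0 -> exists i, coord (vbasis {:U}) i u != 0.
  move=> u0; apply/existsP; apply: contraR u0; rewrite negb_exists => /forallP c0.
  rewrite (coord_vbasis (memvf u)) big1 // => i _.
  by have := c0 i; rewrite negbK => /eqP->; rewrite scale0r.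
apply/idP/idP => [|/orP[]/eqP->]; rewrite ?tens0l ?tens0r //.
apply: contraLR; rewrite negb_or => /andP[/coord0[i vi] /coord0[j wj]].
apply/eqP => /matrixP/(_ i j); rewrite !mxE => /eqP.
by rewrite mulf_eq0 (negPf vi) (negPf wj).
Qed.

Lemma spanned_vbasis V : spanned (fun i : 'I_(\dim {:V}) => (vbasis {:V})`_i).
Proof.
by move=> v; exists (fun i => coord (vbasis {:V}) i v); apply/coord_vbasis/memvf.
Qed.

Lemma tens_vbasis V W (i : 'I_(\dim {:V})) (j : 'I_(\dim {:W})) :
  tens (vbasis {:V})`_i (vbasis {:W})`_j = delta_mx i j.
Proof.
apply/matrixP => i' j'; rewrite !mxE.
rewrite !coord_free ?(basis_free (vbasisP _)) //.
by rewrite -natrM mulnb [i' == i]eq_sym [j' == j]eq_sym.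
Qed.

Lemma tensor_sum V W (t : tensor V W) :
  t = \sum_i \sum_j t i j *: tens (vbasis {:V})`_i (vbasis {:W})`_j.
Proof.
rewrite [LHS]matrix_sum_delta; apply: eq_bigr => i _; apply: eq_bigr => j _.
by rewrite tens_vbasis.
Qed.

Lemma tens_lift_sum V W U (f : V -> W -> U) t :
  tens_lift f t = \sum_i \sum_j t i j *: f (vbasis {:V})`_i (vbasis {:W})`_j.
Proof.
rewrite /tens_lift linfunE // => a s u.
rewrite scaler_sumr -big_split; apply: eq_bigr => i _ /=.
rewrite scaler_sumr -big_split; apply: eq_bigr => j _ /=.
by rewrite !mxE scalerDl scalerA.
Qed.

(** Serves nested lifts, as in [tens_assoc] and [middle_braiding]: there [tens_liftE] asks for
    linearity in a parameter of the inner lift. *)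
Lemma tens_lift_linear V W U (X : vectType k) (f : X -> V -> W -> U) t :
    (forall v w, linear (fun x => f x v w)) ->
  linear (fun x => tens_lift (f x) t).
Proof.
move=> lf a x y; rewrite !tens_lift_sum.
rewrite scaler_sumr -big_split; apply: eq_bigr => i _ /=.
rewrite scaler_sumr -big_split; apply: eq_bigr => j _ /=.
by rewrite lf scalerDr !scalerA mulrC.
Qed.

Lemma spanned_tens V W (I J : finType) (e : I -> V) (f : J -> W) :
    spanned e -> spanned f ->
  spanned (fun p : I * J => tens (e p.1) (f p.2)).
Proof.
move=> spe spf.
have tens_span v w :
    exists c : I * J -> k, tens v w = \sum_p c p *: tens (e p.1) (f p.2).
  have [c ->] := spe v; have [d ->] := spf w.
  exists (fun p => c p.1 * d p.2); rewrite tens_suml.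
  rewrite -(pair_bigA _ (fun i j => (c i * d j) *: tens (e i) (f j))) /=.
  apply: eq_bigr => i _; rewrite tens_sumr; apply: eq_bigr => j _.
  by rewrite tensZl tensZr scalerA.
move=> t; rewrite [t]tensor_sum pair_bigA /=.
elim/big_rec: _ => [|ij u _ [c ->]].
  by exists (fun=> 0); rewrite big1 // => p _; rewrite scale0r.
have [d ->] := tens_span (vbasis {:V})`_ij.1 (vbasis {:W})`_ij.2.
exists (fun p => t ij.1 ij.2 * d p + c p).
rewrite scaler_sumr -big_split; apply: eq_bigr => p _ /=.
by rewrite scalerDl scalerA.
Qed.

Lemma eq_tens_lfun V W U (f g : 'Hom(tensor V W, U)) :
  (forall v w, f (tens v w) = g (tens v w)) -> f = g.
Proof.
move=> eq_fg.
apply: (eq_lfun_spanned (spanned_tens (@spanned_vbasis V) (@spanned_vbasis W))).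
by move=> ij; apply: eq_fg.
Qed.

Lemma tens_mapE V W V' W' (f : 'Hom(V, V')) (g : 'Hom(W, W')) v w :
  tens_map f g (tens v w) = tens (f v) (g w).
Proof.
by rewrite /tens_map tens_liftE // => x a u y; rewrite linearP ?tensPl ?tensPr.
Qed.

Lemma tens_assocE V W U (v : V) (w : W) (u : U) :
  tens_assoc V W U (tens (tens v w) u) = tens v (tens w u).
Proof.
rewrite /tens_assoc tens_liftE; last first.
- by move=> t; apply: tens_lift_linear => x y a z z'; rewrite !tensPr.
- by move=> z a s t; rewrite linearP.
by rewrite tens_liftE // => x a y z; rewrite ?(tensPl, tensPr).
Qed.

End Tensors.

(** * Homogeneous components *)

Section HomogeneousComponents.
Variables (k : fieldType) (G : finGroupType) (V : vectType k).
Variables (gr : G -> {vspace V}) (grP : is_grading gr).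

Lemma homogeneous_comp_mem g v : homogeneous_comp gr g v \in gr g.
Proof. exact: memv_sum_pi. Qed.

Lemma sum_homogeneous_comp v : \sum_g homogeneous_comp gr g v = v.
Proof.
by case/andP: grP => _ /eqP grT; apply: sumv_pi_sum; rewrite // grT memvf.
Qed.

(** The components of [v] and the family with [v] in place [g] and zero elsewhere have the same sum,
    so they agree by directness. *)
Lemma homogeneous_comp_id g h v :
  v \in gr g -> homogeneous_comp gr h v = (h == g)%:R *: v.
Proof.
move=> vg; case/andP: grP => grD _.
have sum_id : \sum_h (h == g)%:R *: v = v.
  rewrite (bigD1 g) //= eqxx scale1r big1 ?addr0 // => h' /negPf->.
  by rewrite scale0r.
have /eqP := etrans (sum_homogeneous_comp v) (esym sum_id).
rewrite (directv_sum_unique grD) => [/forall_inP/(_ h isT)/eqP//|h' _|h' _].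
  exact: homogeneous_comp_mem.
by case: eqP => [->|_]; rewrite ?scale1r ?scale0r ?mem0v.
Qed.

End HomogeneousComponents.

(** * The braiding, and when it is the flip *)

Section Braiding.
Variables (k : closedFieldType) (G : finGroupType) (beta : bicharacter k G).

Lemma braidingE (V W : vectType k)
    (grV : G -> {vspace V}) (grW : G -> {vspace W}) v w :
  braiding beta grV grW (tens v w) =
    \sum_g \sum_h
      beta g h *: tens (homogeneous_comp grW h w) (homogeneous_comp grV g v).
Proof.
rewrite /braiding tens_liftE // => [{}w|{}v] a x y;
  rewrite scaler_sumr -big_split; apply: eq_bigr => g _;
  rewrite scaler_sumr -big_split; apply: eq_bigr => h _ /=;
  by rewrite linearP ?tensPl ?tensPr scalerDr !scalerA mulrC.
Qed.

Variables (H : vectType k) (gr : G -> {vspace H}).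

(** One lift remains, since the braiding of [b] and [c] is in general not a pure tensor. *)
Lemma middle_braidingE a b c d :
  middle_braiding beta gr (tens (tens a b) (tens c d)) =
    tens_lift (fun c' b' => tens (tens a c') (tens b' d))
      (braiding beta gr gr (tens b c)).
Proof.
have lift_linl (x y z : H) :
    linear (fun u : H => tens_lift (fun c' b' => tens (tens u c') (tens b' x))
      (braiding beta gr gr (tens y z))).
  by apply: tens_lift_linear => v w e u u'; rewrite !tensPl.
have lift_linr (x y z : H) :
    linear (fun u : H => tens_lift (fun c' b' => tens (tens x c') (tens b' u))
      (braiding beta gr gr (tens y z))).
  by apply: tens_lift_linear => v w e u u'; rewrite !tensPr.
rewrite /middle_braiding tens_liftE;
  [rewrite tens_liftE; [rewrite tens_liftE //|..]|..].
- by move=> y u x z; rewrite tensPr !linearP.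
- by move=> y; apply: tens_lift_linear => x z; apply: lift_linl.
- by move=> y; apply: tens_lift_linear => x z u v w; rewrite tensPl !linearP.
- by move=> y u x z; rewrite linearP.
- by move=> y; apply: tens_lift_linear => x z u v w; rewrite linearP.
Qed.

Hypothesis grP : is_grading gr.

(** On nonzero homogeneous vectors of degrees [g] and [h] the braiding is [beta g h] times the flip.
    Conversely, only components with degrees in the support contribute to the braiding of two
    vectors. *)
Lemma braiding_flipP :
  (forall v w, braiding beta gr gr (tens v w) = tens w v) <->
  (forall g h, g \in support_gr gr -> h \in support_gr gr -> beta g h = 1).
Proof.
split=> [flip g h|beta1 v w].
  rewrite !inE -!vpick0 => v0 w0.
  set v := vpick _ in v0; set w := vpick _ in w0.
  have [vg wh] : v \in gr g /\ w \in gr h by split; apply: memv_pick.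
  have := flip v w; rewrite braidingE (bigD1 g) //= (bigD1 h) //=.
  rewrite !(homogeneous_comp_id grP _ vg) !(homogeneous_comp_id grP _ wh).
  rewrite !eqxx !scale1r !big1 ?addr0 => [|g' /negPf g'g|h' /negPf h'h].
  - move/eqP; rewrite -subr_eq0 -[X in _ - X]scale1r -scalerBl scaler_eq0.
    by rewrite tens_eq0 (negPf v0) (negPf w0) !orbF subr_eq0 => /eqP.
  - rewrite big1 // => h' _.
    by rewrite (homogeneous_comp_id grP _ vg) g'g scale0r tens0r scaler0.
  - by rewrite (homogeneous_comp_id grP _ wh) h'h scale0r tens0l scaler0.
rewrite braidingE -{2}(sum_homogeneous_comp grP w) -{2}(sum_homogeneous_comp grP v).
rewrite tens_suml exchange_big; apply: eq_bigr => h _.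
rewrite tens_sumr; apply: eq_bigr => g _.
have [gS|] := boolP (g \in support_gr gr); last first.
  rewrite inE negbK => /eqP g0; have := homogeneous_comp_mem gr g v.
  by rewrite g0 memv0 => /eqP->; rewrite tens0r scaler0.
have [hS|] := boolP (h \in support_gr gr); last first.
  rewrite inE negbK => /eqP h0; have := homogeneous_comp_mem gr h w.
  by rewrite h0 memv0 => /eqP->; rewrite tens0l scaler0.
by rewrite beta1 // scale1r.
Qed.

Hypothesis flip : forall v w, braiding beta gr gr (tens v w) = tens w v.

Lemma middle_flipE a b c d :
  middle_braiding beta gr (tens (tens a b) (tens c d)) =
    tens (tens a c) (tens b d).
Proof.
rewrite middle_braidingE flip tens_liftE // => z u x y;
  by rewrite !(tensPl, tensPr).
Qed.

End Braiding.

(** * Gradings as weight decompositions under the characters of [G] *)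

(** The common interface of the gradings on [kGamma], on its dual and on tensor products: however
    they are defined, their pieces are the joint eigenspaces of an action of the characters. *)
Record weight_grading (k : closedFieldType) (G : finGroupType) (V : vectType k)
    (op : char_group k G -> 'End(V)) (gr : G -> {vspace V}) : Prop := {
  weight_op1 : forall v, op 1%g v = v;
  weight_opM : forall a b v, op (a * b)%g v = op a (op b v);
  weight_mem : forall g v, v \in gr g <-> forall a, op a v = a g *: v }.

Section Weights.
Variables (k : closedFieldType) (char0 : [pchar k] =i pred0).
Variables (G : finGroupType) (abelG : abelian [set: G]).
Let A := char_group k G.

(** For a weight grading, this is [#|A|] times the projection onto degree [g]. *)
Definition weight_proj (V : vectType k) (op : A -> 'End(V)) (g : G) : 'End(V) :=
  \sum_(a : A) (a g)^-1 *: op a.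

Lemma weight_projE (V : vectType k) (op : A -> 'End(V)) g v :
  weight_proj op g v = \sum_(a : A) (a g)^-1 *: op a v.
Proof.
by rewrite sum_lfunE; apply: eq_bigr => a _; rewrite scale_lfunE.
Qed.

(** Orthogonality of characters. It is stated for weight vectors rather than members of a grading,
    so that it applies to tensors before their graded pieces are identified. *)
Lemma weight_proj_id (V : vectType k) (op : A -> 'End(V)) g h v :
    (forall a, op a v = a g *: v) ->
  weight_proj op h v = ((g == h)%:R * #|{: A}|%:R) *: v.
Proof.
move=> vg; rewrite weight_projE.
under eq_bigr => a _ do rewrite vg scalerA -charV // -charM.
rewrite -scaler_suml; case: eqP => [->|/eqP gh].
  under eq_bigr => a _ do rewrite mulVg char1.
  by rewrite sumr_const mul1r.
by rewrite sum_char_eq0 ?mul0r // -eq_mulVg1 eq_sym.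
Qed.

Section OneSpace.
Variables (V : vectType k) (op : A -> 'End(V)) (gr : G -> {vspace V}).
Hypothesis grW : weight_grading op gr.

Lemma weight_proj_mem g v : weight_proj op g v \in gr g.
Proof.
apply/(weight_mem grW) => b; rewrite weight_projE linear_sum scaler_sumr.
rewrite [RHS](reindex_inj (mulgI b)); apply: eq_bigr => a _.
rewrite linearZ /= -(weight_opM grW) scalerA char_charM invfM mulrA.
by rewrite divff ?char_neq0 ?mul1r.
Qed.

(** Once the sums are exchanged, the sum over [g] kills every term except that of the trivial
    character. *)
Lemma sum_weight_proj v : \sum_g weight_proj op g v = #|G|%:R *: v.
Proof.
under eq_bigr => g _ do rewrite weight_projE.
rewrite exchange_big /=.
have sum_g (a : A) :
    \sum_g (a g)^-1 *: op a v = if a == 1%g then #|G|%:R *: v else 0.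
  under eq_bigr => g _ do rewrite -char_charV.
  rewrite -scaler_suml; case: eqP => [->|/eqP a1].
    rewrite (weight_op1 grW) invg1; congr (_ *: v).
    by under eq_bigr => g _ do rewrite char_char1; rewrite sumr_const.
  by rewrite sum_group_char_eq0 ?scale0r // invg_eq1.
by rewrite (eq_bigr _ (fun a _ => sum_g a)) -big_mkcond big_pred1_eq.
Qed.

(** Directness: [weight_proj op g] extracts from a vanishing sum [#|A|] times its term of degree
    [g], and [#|A|] is invertible in characteristic 0. Generation: divide [sum_weight_proj] by
    [#|G|]. *)
Lemma weight_is_grading : is_grading gr.
Proof.
apply/andP; split.
  apply/directv_sum_independent => u ugr u0 g _.
  have : weight_proj op g (\sum_h u h) = 0 by rewrite u0 linear0.
  rewrite linear_sum (bigD1 g) //= big1 ?addr0 => [|h /negPf hg].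
    rewrite (weight_proj_id _ ((weight_mem grW _ _).1 (ugr g isT))).
    rewrite eqxx mul1r => /eqP; rewrite scaler_eq0.
    rewrite (negPf (natr_card_neq0 char0 _)) => [/eqP//|].
    by apply/card_gt0P; exists 1%g.
  rewrite (weight_proj_id _ ((weight_mem grW _ _).1 (ugr h isT))).
  by rewrite hg mul0r scale0r.
apply/eqP/vspaceP => v; rewrite memvf.
have G0 : #|G|%:R != 0 :> k.
  by rewrite natr_card_neq0 //; apply/card_gt0P; exists 1%g.
rewrite -[v]scale1r -(mulVf G0) -scalerA -sum_weight_proj memvZ //.
by apply: memv_suml => g _; apply: subvP (sumv_sup g _ _) _ (weight_proj_mem g v).
Qed.

(** In degree [g != 1] some character has [a g != 1], so an invariant form vanishes there. *)
Lemma graded_triv (f : 'Hom(V, k^o)) :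
  (forall a v, f (op a v) = f v) -> graded_map gr (@triv_grading k G) f.
Proof.
move=> fop g; apply/subvP => _ /memv_imgP[v /(weight_mem grW) vg ->].
rewrite /triv_grading; case: eqP => [_|/eqP/(char_separates1 char0 abelG)[a ag]].
  exact: memvf.
have /eqP := fop a v; rewrite vg linearZ /= -subr_eq0 -[X in _ - X]scale1r.
by rewrite -scalerBl scaler_eq0 subr_eq0 (negPf ag) memv0.
Qed.

End OneSpace.

Section TwoSpaces.
Variables (V W : vectType k) (opV : A -> 'End(V)) (opW : A -> 'End(W)).
Variables (grV : G -> {vspace V}) (grW : G -> {vspace W}).
Hypotheses (grVw : weight_grading opV grV) (grWw : weight_grading opW grW).

Lemma graded_equivariant (f : 'Hom(V, W)) :
  (forall a v, f (opV a v) = opW a (f v)) -> graded_map grV grW f.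
Proof.
move=> fop g; apply/subvP => _ /memv_imgP[v /(weight_mem grVw) vg ->].
by apply/(weight_mem grWw) => a; rewrite -fop vg linearZ.
Qed.

Lemma tens_grading_mem g h v w :
  v \in grV g -> w \in grW h -> tens v w \in tens_grading grV grW (g * h)%g.
Proof.
move=> vg wh; apply: subvP (sumv_sup g _ (subvv _)) _ _ => //.
rewrite mulKg (coord_vbasis vg) (coord_vbasis wh) tens_suml memv_suml // => i _.
rewrite tens_sumr memv_suml // => j _; rewrite tensZl tensZr !memvZ //.
apply/memv_span/allpairsP; exists ((vbasis (grV g))`_i, (vbasis (grW h))`_j).
by split; rewrite // mem_nth ?size_tuple.
Qed.

Definition tens_op (a : A) : 'End(tensor V W) := tens_map (opV a) (opW a).

Lemma tens_weight_grading : weight_grading tens_op (tens_grading grV grW).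
Proof.
have ext (f g : 'End(tensor V W)) :
    (forall v w, f (tens v w) = g (tens v w)) -> forall t, f t = g t.
  by move=> fg t; rewrite (eq_tens_lfun fg).
split.
- move=> t; rewrite -[RHS](@id_lfunE k); apply: ext => v w.
  by rewrite tens_mapE (weight_op1 grVw) (weight_op1 grWw) id_lfunE.
- move=> a b t; rewrite -comp_lfunE; apply: ext => v w.
  by rewrite comp_lfunE !tens_mapE (weight_opM grVw) (weight_opM grWw).
move=> g t; split=> [|tg].
  move=> + a; suff sub :
    (tens_grading grV grW g <= lker (tens_op a - a g *: \1%VF)%R)%VS.
    move/(subvP sub); rewrite memv_ker add_lfunE opp_lfunE scale_lfunE id_lfunE.
    by rewrite subr_eq0 => /eqP.
  apply/subv_sumP => h _; apply/span_subvP => _ /allpairsP[[v w] /= [vh wh ->]].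
  rewrite memv_ker add_lfunE opp_lfunE scale_lfunE id_lfunE subr_eq0 tens_mapE.
  rewrite ((weight_mem grVw _ _).1 (vbasis_mem vh)).
  rewrite ((weight_mem grWw _ _).1 (vbasis_mem wh)).
  by rewrite tensZl tensZr scalerA -charM mulKVg.
have A0 : #|{: A}|%:R != 0 :> k.
  by rewrite natr_card_neq0 //; apply/card_gt0P; exists 1%g.
(* A tensor of weight [g] is its own projection up to the factor [#|A|]. It thus suffices that the
   projection of every tensor lies in the piece of degree [g], which can be tested on pure tensors
   of homogeneous vectors. *)
rewrite -[t]scale1r -(mulVf A0) -scalerA memvZ // -[_%:R]mul1r.
rewrite -[X in X * _](_ : (g == g)%:R = _); last by rewrite eqxx.
rewrite -(weight_proj_id _ tg) {tg}.
elim/(spanned_ind (spanned_tens (@spanned_vbasis _ V) (@spanned_vbasis _ W))): t.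
- by move=> a t u tg ug; rewrite linearP memvD ?memvZ.
- by rewrite linear0 mem0v.
move=> [i j] /=; move: (_`_i) (_`_j) => v w.
rewrite -(sum_homogeneous_comp (weight_is_grading grVw) v).
rewrite -(sum_homogeneous_comp (weight_is_grading grWw) w).
rewrite tens_suml linear_sum memv_suml // => h _.
rewrite tens_sumr linear_sum memv_suml // => h' _.
(* The tensor of components of degrees [h] and [h'] has weight [h * h']: its projection is a
   multiple of itself if this is [g], and 0 otherwise. *)
rewrite /= (@weight_proj_id _ _ (h * h')%g).
  have [<-|_] := eqP; last by rewrite mul0r scale0r mem0v.
  by rewrite memvZ // tens_grading_mem // homogeneous_comp_mem.
move=> a; rewrite tens_mapE charM -scalerA.
have /(weight_mem grVw)-> := homogeneous_comp_mem grV h v.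
have /(weight_mem grWw)-> := homogeneous_comp_mem grW h' w.
by rewrite tensZl tensZr.
Qed.

End TwoSpaces.

End Weights.

(** * The group algebra: structure maps and action on group elements *)

Section GroupAlgebraHopf.
Variables (k : closedFieldType) (Gamma : finGroupType).
Local Notation e := (ga_elt k).
Implicit Types s t : Gamma.

Lemma ga_eltE s t : e s t = (s == t)%:R.
Proof. by rewrite ffunE. Qed.

Lemma group_alg_sum (x : group_alg k Gamma) : x = \sum_s x s *: e s.
Proof.
apply/ffunP => t; rewrite sum_ffunE (bigD1 t) //= !ffunE eqxx.
rewrite big1 ?addr0 => [|s /negPf st]; first by rewrite [_ *: _]mulr1.
by rewrite !ffunE st [_ *: _]mulr0.
Qed.

Lemma spanned_ga_elt : spanned (fun s => e s).
Proof. by move=> x; exists x; apply: group_alg_sum. Qed.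

Lemma linear_ga_ext (W : vectType k) (f : Gamma -> W) :
  linear (fun x : group_alg k Gamma => \sum_s x s *: f s).
Proof.
move=> a x y; rewrite scaler_sumr -big_split; apply: eq_bigr => s _.
by rewrite !ffunE scalerDl scalerA.
Qed.

(** Evaluates the maps defined by linear extension from [Gamma]: the coproduct, the antipode, the
    action and the translations. *)
Lemma ga_extE (W : vectType k) (f : Gamma -> W) t :
  linfun (fun x : group_alg k Gamma => \sum_s x s *: f s) (e t) = f t.
Proof.
rewrite linfunE; last exact: linear_ga_ext.
rewrite (bigD1 t) //= ga_eltE eqxx scale1r big1 ?addr0 // => s /negPf st.
by rewrite ga_eltE eq_sym st scale0r.
Qed.

Lemma ga_mulE s t : ga_mul k Gamma (tens (e s) (e t)) = e (s * t)%g.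
Proof.
rewrite /ga_mul tens_liftE => [|y a x x'|x a y y'].
- rewrite (bigD1 s) //= (bigD1 t) //= !ga_eltE !eqxx mulr1 scale1r.
  rewrite !big1 ?addr0 // => [s' /negPf ss|t' /negPf tt].
    by rewrite big1 // => t' _; rewrite !ga_eltE eq_sym ss mul0r scale0r.
  by rewrite !ga_eltE [t == t']eq_sym tt mulr0 scale0r.
- rewrite scaler_sumr -big_split; apply: eq_bigr => s' _ /=.
  rewrite scaler_sumr -big_split; apply: eq_bigr => t' _ /=.
  by rewrite !ffunE mulrDl scalerDl scalerA mulrA.
- rewrite scaler_sumr -big_split; apply: eq_bigr => s' _ /=.
  rewrite scaler_sumr -big_split; apply: eq_bigr => t' _ /=.
  by rewrite !ffunE mulrDr scalerDl scalerA mulrCA.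
Qed.

Lemma ga_comulE s : ga_comul k Gamma (e s) = tens (e s) (e s).
Proof. exact: ga_extE. Qed.

Lemma ga_counitE s : ga_counit k Gamma (e s) = 1.
Proof.
rewrite /ga_counit linfunE => [|a x y].
  rewrite (bigD1 s) //= ga_eltE eqxx big1 ?addr0 // => t /negPf ts.
  by rewrite ga_eltE eq_sym ts.
by rewrite scaler_sumr -big_split; apply: eq_bigr => t _; rewrite !ffunE.
Qed.

Definition ga_antipode : 'End(group_alg k Gamma) :=
  linfun (fun x : group_alg k Gamma => \sum_s x s *: e s^-1%g).

Lemma ga_antipodeE s : ga_antipode (e s) = e s^-1%g.
Proof. exact: ga_extE. Qed.

Variables (char0 : [pchar k] =i pred0).
Variables (G : finGroupType) (abelG : abelian [set: G]).
Variable to : groupAction [set: char_group k G] [set: Gamma].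

Lemma ga_actE a s : ga_act to a (e s) = e (to s a).
Proof. exact: ga_extE. Qed.

Lemma act_autM a s t : to (s * t)%g a = (to s a * to t a)%g.
Proof. by rewrite gactM ?inE. Qed.

Lemma act_aut1 a : to 1%g a = 1%g.
Proof. by rewrite gact1 ?inE. Qed.

Lemma act_autV a s : to s^-1%g a = (to s a)^-1%g.
Proof. by rewrite gactV ?inE. Qed.

Lemma ga_act1 x : ga_act to 1%g x = x.
Proof.
rewrite -[RHS](@id_lfunE k); congr (fun_of_lfun _ x).
by apply: (eq_lfun_spanned spanned_ga_elt) => s; rewrite ga_actE act1 id_lfunE.
Qed.

Lemma ga_actM a b x : ga_act to (a * b)%g x = ga_act to a (ga_act to b x).
Proof.
rewrite -comp_lfunE; congr (fun_of_lfun _ x).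
apply: (eq_lfun_spanned spanned_ga_elt) => s; rewrite comp_lfunE !ga_actE.
(* [to] is a right action, so the two characters come out in the opposite order. *)
by rewrite -actMin ?inE // char_mulC.
Qed.

Lemma ga_weight_grading : weight_grading (ga_act to) (ga_grading to).
Proof.
split=> [x|a b x|g x]; [exact: ga_act1 | exact: ga_actM |].
rewrite /ga_grading memvE; split=> [/subv_bigcapP xg a|xg].
  have := xg a isT; rewrite -memvE /passmx.leigenspace memv_ker.
  by rewrite add_lfunE opp_lfunE scale_lfunE id_lfunE subr_eq0 => /eqP.
apply/subv_bigcapP => a _; rewrite -memvE /passmx.leigenspace memv_ker.
by rewrite add_lfunE opp_lfunE scale_lfunE id_lfunE subr_eq0 xg.
Qed.

End GroupAlgebraHopf.

(** * The group algebra as a color Hopf algebra *)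

Section GroupAlgebraColorHopf.
Variables (k : closedFieldType) (char0 : [pchar k] =i pred0).
Variables (G : finGroupType) (abelG : abelian [set: G]).
Variables (beta : bicharacter k G) (Gamma : finGroupType).
Variable to : groupAction [set: char_group k G] [set: Gamma].
Local Notation e := (ga_elt k).
Local Notation gr := (ga_grading to).
Local Notation mul := (ga_mul k Gamma).
Local Notation comul := (ga_comul k Gamma).
Local Notation counit := (ga_counit k Gamma).
Local Notation spe := (@spanned_ga_elt k Gamma).
Local Notation grW := (ga_weight_grading to).
Let tgrW := tens_weight_grading char0 abelG grW grW.

Lemma ga_graded_algebra : is_graded_algebra gr mul (e 1%g).
Proof.
split.
- apply: (graded_equivariant tgrW grW) => a t.
  rewrite -!comp_lfunE; congr (fun_of_lfun _ t).
  apply: (eq_lfun_spanned (spanned_tens spe spe)) => -[s u] /=.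
  by rewrite !comp_lfunE /= tens_mapE !ga_actE !ga_mulE ga_actE act_autM.
- by apply/(weight_mem grW) => a; rewrite ga_actE act_aut1 char1 scale1r.
- move=> x y z.
  elim/(spanned_ind spe): x => [a u v IHu IHv||s].
  + by rewrite !(tensPl, linearP) /= IHu IHv.
  + by rewrite !(tens0l, linear0).
  elim/(spanned_ind spe): y => [a u v IHu IHv||t].
  + by rewrite !(tensPl, tensPr, linearP) /= IHu IHv.
  + by rewrite !(tens0l, tens0r, linear0).
  elim/(spanned_ind spe): z => [a u v IHu IHv||r].
  + by rewrite !(tensPr, linearP) /= IHu IHv.
  + by rewrite !(tens0r, linear0).
  by rewrite !ga_mulE mulgA.
- elim/(spanned_ind spe) => [a u v IHu IHv||s].
  + by rewrite tensPr linearP /= IHu IHv.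
  + by rewrite tens0r linear0.
  by rewrite ga_mulE mul1g.
- elim/(spanned_ind spe) => [a u v IHu IHv||s].
  + by rewrite tensPl linearP /= IHu IHv.
  + by rewrite tens0l linear0.
  by rewrite ga_mulE mulg1.
Qed.

Lemma ga_graded_coalgebra : is_graded_coalgebra gr comul counit.
Proof.
split.
- apply: (graded_equivariant grW tgrW) => a x.
  rewrite -!comp_lfunE; congr (fun_of_lfun _ x).
  apply: (eq_lfun_spanned spe) => s.
  by rewrite !comp_lfunE !ga_actE !ga_comulE tens_mapE !ga_actE.
- apply: (graded_triv char0 abelG grW) => a x.
  rewrite -!comp_lfunE; congr (fun_of_lfun _ x).
  by apply: (eq_lfun_spanned spe) => s; rewrite !comp_lfunE ga_actE !ga_counitE.
- apply: (eq_lfun_spanned spe) => s.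
  by rewrite !comp_lfunE !ga_comulE !tens_mapE !id_lfunE ga_comulE tens_assocE.
- elim/(spanned_ind spe) => [a u v IHu IHv||s].
  + by rewrite !linearP /= IHu IHv.
  + by rewrite !linear0.
  rewrite ga_comulE tens_liftE => [|y a u v|x a u v].
  + by rewrite ga_counitE scale1r.
  + by rewrite linearP /= scalerDl scalerA.
  + by rewrite scalerDr !scalerA mulrC.
- elim/(spanned_ind spe) => [a u v IHu IHv||s].
  + by rewrite !linearP /= IHu IHv.
  + by rewrite !linear0.
  rewrite ga_comulE tens_liftE => [|y a u v|x a u v].
  + by rewrite ga_counitE scale1r.
  + by rewrite scalerDr !scalerA mulrC.
  + by rewrite linearP /= scalerDl scalerA.
Qed.

Lemma ga_antipode_color :
  is_color_antipode gr mul (e 1%g) comul counit (ga_antipode k Gamma).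
Proof.
split.
- apply: (graded_equivariant grW grW) => a x.
  rewrite -!comp_lfunE; congr (fun_of_lfun _ x).
  apply: (eq_lfun_spanned spe) => s.
  by rewrite !comp_lfunE ga_actE !ga_antipodeE ga_actE act_autV.
- have invol : involutive (ga_antipode k Gamma).
    move=> x; rewrite -comp_lfunE -[RHS](@id_lfunE k); congr (fun_of_lfun _ x).
    apply: (eq_lfun_spanned spe) => s.
    by rewrite comp_lfunE !ga_antipodeE invgK id_lfunE.
  by exists (ga_antipode k Gamma).
- elim/(spanned_ind spe) => [a u v IHu IHv||s].
  + by rewrite !linearP /= IHu IHv scalerDl scalerA.
  + by rewrite !linear0 scale0r.
  by rewrite ga_comulE tens_mapE id_lfunE ga_antipodeE ga_mulE ga_counitE mulVg scale1r.
- elim/(spanned_ind spe) => [a u v IHu IHv||s].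
  + by rewrite !linearP /= IHu IHv scalerDl scalerA.
  + by rewrite !linear0 scale0r.
  by rewrite ga_comulE tens_mapE id_lfunE ga_antipodeE ga_mulE ga_counitE mulgV scale1r.
Qed.

Lemma ga_color_HopfP :
  is_color_Hopf_algebra beta gr mul (e 1%g) comul counit <->
  (forall v w, braiding beta gr gr (tens v w) = tens w v).
Proof.
split=> [[[_ _ _ comulM _ _ _] _]|flip].
  move=> v w; pose flip := tens_lift (fun x y : group_alg k Gamma => tens y x).
  have flipE x y : flip (tens x y) = tens y x.
    by rewrite /flip tens_liftE // => z a u u'; rewrite ?(tensPl, tensPr).
  rewrite -[RHS]flipE; congr (fun_of_lfun _ _) => {v w}.
  apply: (eq_lfun_spanned (spanned_tens spe spe)) => -[s t] /=; rewrite flipE.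
  pose L (s : Gamma) : 'End(group_alg k Gamma) :=
    linfun (fun x : group_alg k Gamma => \sum_u x u *: e (s * u)%g).
  pose R (s : Gamma) : 'End(group_alg k Gamma) :=
    linfun (fun x : group_alg k Gamma => \sum_u x u *: e (u * s)%g).
  have LE u v : L u (e v) = e (u * v)%g by exact: ga_extE.
  have RE u v : R u (e v) = e (v * u)%g by exact: ga_extE.
  (* The coproduct of [s * t] is [s * t] tensored with itself; the two translations turn it into [t]
     tensored with [s]. *)
  have /(congr1 (tens_map (L s^-1%g) (R t^-1%g))) :=
    congr1 (fun f => fun_of_lfun f (tens (e s) (e t))) comulM.
  rewrite !comp_lfunE ga_mulE ga_comulE tens_mapE LE RE mulKg mulgK => ->.
  rewrite tens_mapE !ga_comulE middle_braidingE.
  (* For any tensor [z] in place of the braiding, the products multiply by [s] on the left and by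
     [t] on the right, and the translations undo this. *)
  move: (braiding _ _ _ _) => z.
  elim/(spanned_ind (spanned_tens spe spe)): z => [a u v IHu IHv||[u v]] /=.
  + by rewrite !linearP /= -IHu -IHv.
  + by rewrite !linear0.
  rewrite tens_liftE; [|by move=> b a x y; rewrite !(tensPl, tensPr)..].
  by rewrite !tens_mapE !ga_mulE LE RE mulKg mulgK.
split; last by exists (ga_antipode k Gamma); apply: ga_antipode_color.
have grP := weight_is_grading char0 abelG grW.
split; [by []|exact: ga_graded_algebra|exact: ga_graded_coalgebra|..].
- apply: (eq_lfun_spanned (spanned_tens spe spe)) => -[s t] /=.
  rewrite !comp_lfunE ga_mulE ga_comulE !tens_mapE !ga_comulE.
  by rewrite (middle_flipE flip) tens_mapE ga_mulE.
- by rewrite ga_comulE.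
- move=> x y; elim/(spanned_ind spe): x => [a u v IHu IHv||s].
  + by rewrite tensPl !linearP /= IHu IHv mulrDl; congr (_ + _); apply: mulrA.
  + by rewrite tens0l !linear0 mul0r.
  elim/(spanned_ind spe): y => [a u v IHu IHv||t].
  + by rewrite tensPr !linearP /= IHu IHv mulrDr; congr (_ + _); apply: mulrCA.
  + by rewrite tens0r !linear0 mulr0.
  by rewrite ga_mulE !ga_counitE mulr1.
- exact: ga_counitE.
Qed.

End GroupAlgebraColorHopf.

(** * The dual grading and the contragredient action *)

Section DualGrading.
Variables (k : closedFieldType) (char0 : [pchar k] =i pred0).
Variables (G : finGroupType) (abelG : abelian [set: G]).
Let A := char_group k G.
Variables (V : vectType k) (gr : G -> {vspace V}).

(** [projv (gr h)] has image in [gr h] and fixes it pointwise, so a form is killed by composition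
    with it iff it vanishes on [gr h]. *)
Lemma dual_grading_mem g (f : dual V) :
  f \in dual_grading gr g <->
  (forall h v, h != g^-1%g -> v \in gr h -> f v = 0).
Proof.
have comp_lin U : linear (fun f : dual V => (f \o projv U)%VF : dual V).
  by move=> a u v; rewrite comp_lfunDl comp_lfunZl.
rewrite /dual_grading memvE; split=> [/subv_bigcapP fg h v hg vh|fg].
  have := fg h hg; rewrite -memvE memv_ker linfunE // => /eqP/lfunP/(_ v).
  by rewrite comp_lfunE zero_lfunE /= projv_id.
apply/subv_bigcapP => h hg; rewrite -memvE memv_ker linfunE //.
by apply/eqP/lfunP => v; rewrite comp_lfunE zero_lfunE (fg h) // memv_proj.
Qed.

Lemma dual_support : is_grading gr ->
  forall g, (g \in support_gr (dual_grading gr)) = (g^-1%g \in support_gr gr).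
Proof.
move=> grP g; rewrite !inE; apply/idP/idP.
  rewrite -vpick0; apply: contraNneq => gr0.
  apply/eqP/lfunP => v; rewrite zero_lfunE -(sum_homogeneous_comp grP v).
  have /dual_grading_mem fg := memv_pick (dual_grading gr g).
  rewrite linear_sum big1 // => h _; have := homogeneous_comp_mem gr h v.
  have [->|hg] := eqVneq h g^-1%g; last exact: fg.
  by rewrite gr0 memv0 => /eqP->; rewrite linear0.
rewrite -vpick0; apply: contraNneq => dual0; have := memv_pick (gr g^-1%g).
move: (vpick _) => v vg; rewrite (coord_vbasis (memvf v)) big1 // => i _.
(* The coordinate form composed with the component of degree [g^-1] has degree [g] in the dual,
   hence is zero; so every coordinate of [v] vanishes. *)
pose c : dual V := linfun (coord (vbasis {:V}) i : V -> k^o).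
suff : (c \o homogeneous_comp gr g^-1%g)%VF = 0 :> dual V.
  move/lfunP/(_ v); rewrite comp_lfunE (homogeneous_comp_id grP _ vg) eqxx scale1r.
  by rewrite zero_lfunE lfunE /= => ->; rewrite scale0r.
apply/eqP; rewrite -memv0 -dual0; apply/dual_grading_mem => h w hg wh.
by rewrite comp_lfunE (homogeneous_comp_id grP _ wh) eq_sym (negPf hg) scale0r linear0.
Qed.

Variable op : A -> 'End(V).

Definition dual_op (a : A) : 'End(dual V) :=
  linfun (fun f : dual V => (f \o op a^-1%g)%VF : dual V).

Lemma dual_opE a f v : (dual_op a f : dual V) v = f (op a^-1%g v).
Proof.
rewrite linfunE ?comp_lfunE // => b u w.
by rewrite comp_lfunDl comp_lfunZl.
Qed.

Hypothesis grW : weight_grading op gr.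

Lemma dual_weight_grading : weight_grading dual_op (dual_grading gr).
Proof.
split=> [f|a b f|g f].
- by apply/lfunP => v; rewrite dual_opE invg1 (weight_op1 grW).
- by apply/lfunP => v; rewrite !dual_opE invMg (weight_opM grW).
have grP := weight_is_grading char0 abelG grW.
split=> [/dual_grading_mem fg a|fg].
  apply/lfunP => v; rewrite dual_opE scale_lfunE -(sum_homogeneous_comp grP v).
  rewrite !linear_sum; apply: eq_bigr => h _ /=.
  have vh := homogeneous_comp_mem gr h v.
  rewrite ((weight_mem grW h _).1 vh) linearZ /=.
  have [->|hg] := eqVneq h g^-1%g; first by rewrite char_charV -charV invgK.
  by rewrite (fg h) // !scaler0.
(* If [f v != 0] with [v] of degree [h], comparing scalars gives [a h = a g^-1] for every character
   [a], so [h = g^-1]. *)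
apply/dual_grading_mem => h v + vh; apply: contraNeq => fv.
apply/eqP/(char_inj char0 abelG) => a; have := fg a^-1%g => /lfunP/(_ v).
rewrite dual_opE invgK scale_lfunE ((weight_mem grW h _).1 vh) linearZ /=.
by rewrite char_charV charV => /(mulIf fv).
Qed.

End DualGrading.

(** * Functions on [Gamma]: structure maps on the basis of deltas *)

Section FunctionAlgebra.
Variables (k : closedFieldType) (Gamma : finGroupType).
Local Notation e := (ga_elt k).
Local Notation F := (dual (group_alg k Gamma)).
Local Notation delta := (ga_delta k).
Local Notation mul := (gf_mul k Gamma).
Local Notation one := (gf_one k Gamma).
Local Notation comul := (gf_comul k Gamma).
Local Notation counit := (gf_counit k Gamma).
Implicit Types (s t u : Gamma) (f h : F).

Lemma ga_deltaE s t : (delta s : F) (e t) = (t == s)%:R.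
Proof.
by rewrite linfunE ?ga_eltE // => a x y; rewrite !ffunE.
Qed.

Lemma eq_gf f h : (forall s, f (e s) = h (e s)) -> f = h.
Proof. exact: (eq_lfun_spanned (@spanned_ga_elt k Gamma)). Qed.

Lemma gf_sumE (I : finType) (c : I -> k) (d : I -> F) s :
  (\sum_i c i *: d i : F) (e s) = \sum_i c i * d i (e s).
Proof.
by rewrite sum_lfunE; apply: eq_bigr => i _; rewrite scale_lfunE.
Qed.

Lemma gf_sum f : f = \sum_s f (e s) *: delta s.
Proof.
apply: eq_gf => t; rewrite gf_sumE (bigD1 t) //= ga_deltaE eqxx mulr1.
rewrite big1 ?addr0 // => s /negPf st.
by rewrite ga_deltaE eq_sym st mulr0.
Qed.

Lemma spanned_ga_delta : spanned (fun s => delta s : F).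
Proof. by move=> f; exists (fun s => f (e s)); apply: gf_sum. Qed.

Lemma gf_mulE f h s : (mul (tens f h) : F) (e s) = f (e s) * h (e s).
Proof.
rewrite /gf_mul tens_liftE => [|{}h a f1 f2|{}f a h1 h2].
- rewrite gf_sumE (bigD1 s) //= ga_deltaE eqxx mulr1 big1 ?addr0 // => t /negPf ts.
  by rewrite ga_deltaE eq_sym ts mulr0.
- rewrite scaler_sumr -big_split; apply: eq_bigr => t _ /=.
  by rewrite add_lfunE scale_lfunE mulrDl scalerDl scalerA mulrA.
- rewrite scaler_sumr -big_split; apply: eq_bigr => t _ /=.
  by rewrite add_lfunE scale_lfunE mulrDr scalerDl scalerA mulrCA.
Qed.

Lemma gf_mul_delta s t : mul (tens (delta s) (delta t)) = (s == t)%:R *: delta s.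
Proof.
apply: eq_gf => u; rewrite gf_mulE scale_lfunE !ga_deltaE.
have [->|us] := eqVneq u s; first by rewrite mul1r [_ *: _]mulr1.
by rewrite mul0r [_ *: _]mulr0.
Qed.

Lemma gf_oneE s : (one : F) (e s) = 1.
Proof.
rewrite /gf_one sum_lfunE (bigD1 s) //= ga_deltaE eqxx big1 ?addr0 // => t /negPf ts.
by rewrite ga_deltaE eq_sym ts.
Qed.

Lemma gf_counitE f : counit f = f (e 1%g).
Proof. by rewrite linfunE // => a f1 f2; rewrite add_lfunE scale_lfunE. Qed.

Lemma gf_comul_delta u :
  comul (delta u) = \sum_s tens (delta s) (delta (s^-1 * u)%g).
Proof.
rewrite /gf_comul linfunE => [|a f1 f2].
  apply: eq_bigr => s _; rewrite (bigD1 (s^-1 * u)%g) //= ga_deltaE mulKVg eqxx.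
  rewrite scale1r big1 ?addr0 // => t /negPf tsu.
  by rewrite ga_deltaE -(inj_eq (mulgI s^-1%g)) mulKg tsu scale0r.
rewrite scaler_sumr -big_split; apply: eq_bigr => s _ /=.
rewrite scaler_sumr -big_split; apply: eq_bigr => t _ /=.
by rewrite add_lfunE scale_lfunE scalerDl scalerA.
Qed.

(** The same coproduct indexed by its second factor, for the places where that factor is the one to
    be fixed. *)
Lemma gf_comul_deltaV u :
  comul (delta u) = \sum_t tens (delta (u * t^-1)%g) (delta t).
Proof.
rewrite gf_comul_delta (reindex (fun t => u * t^-1)%g) /=.
  by apply: eq_bigr => t _; rewrite invMg invgK mulgKV.
by exists (fun s => s^-1 * u)%g => s _; rewrite ?invMg ?invgK ?mulgKV ?mulKVg.
Qed.

Definition gf_antipode : 'End(F) :=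
  linfun (fun f : F => \sum_s f (e s) *: (delta s^-1%g : F)).

Lemma gf_antipodeE f s : (gf_antipode f : F) (e s) = f (e s^-1%g).
Proof.
rewrite linfunE => [|a f1 f2].
  rewrite gf_sumE (bigD1 s^-1%g) //= ga_deltaE invgK eqxx mulr1.
  rewrite big1 ?addr0 // => t /negPf ts.
  by rewrite ga_deltaE -(inj_eq invg_inj) invgK eq_sym ts mulr0.
rewrite scaler_sumr -big_split; apply: eq_bigr => t _ /=.
by rewrite add_lfunE scale_lfunE scalerDl scalerA.
Qed.

Lemma gf_antipode_delta s : gf_antipode (delta s) = delta s^-1%g.
Proof.
apply: eq_gf => t; rewrite gf_antipodeE !ga_deltaE.
by rewrite -(inj_eq invg_inj) invgK.
Qed.

(* The evaluation of a tensor, seen as a function on [Gamma * Gamma]. *)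
Definition gf_ev s t : 'Hom(tensor F F, k^o) :=
  tens_lift (fun f h : F => f (e s) * h (e t) : k^o).

Lemma gf_evE s t f h : gf_ev s t (tens f h) = f (e s) * h (e t).
Proof.
rewrite /gf_ev tens_liftE // => [{}h|{}f] a f1 f2.
  by rewrite add_lfunE scale_lfunE mulrDl; congr (_ + _); rewrite -[LHS]mulrA.
by rewrite add_lfunE scale_lfunE mulrDr; congr (_ + _); apply: mulrCA.
Qed.

(** The values of a tensor are its coefficients on the tensors of deltas. *)
Lemma eq_gf_ev (z z' : tensor F F) :
  (forall s t, gf_ev s t z = gf_ev s t z') -> z = z'.
Proof.
have ev_sum y : y = \sum_s \sum_t gf_ev s t y *: tens (delta s : F) (delta t : F).
  elim/(spanned_ind (spanned_tens spanned_ga_delta spanned_ga_delta)): y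
    => [a y y' {1}-> {1}->||[u v]] /=.
  - rewrite scaler_sumr -big_split; apply: eq_bigr => s _ /=.
    rewrite scaler_sumr -big_split; apply: eq_bigr => t _ /=.
    by rewrite linearP /= scalerDl scalerA.
  - by rewrite big1 // => s _; rewrite big1 // => t _; rewrite linear0 scale0r.
  rewrite (bigD1 u) //= (bigD1 v) //= gf_evE !ga_deltaE !eqxx mulr1 scale1r.
  rewrite !big1 ?addr0 // => [s /negPf su|t /negPf tv].
    by rewrite big1 // => t _; rewrite gf_evE !ga_deltaE su mul0r scale0r.
  by rewrite gf_evE !ga_deltaE tv mulr0 scale0r.
move=> eq_zz; rewrite [z]ev_sum [z']ev_sum; apply: eq_bigr => s _.
by apply: eq_bigr => t _; rewrite eq_zz.
Qed.

Lemma gf_ev_comul s t f : gf_ev s t (comul f) = f (e (s * t)%g).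
Proof.
elim/(spanned_ind spanned_ga_delta): f => [a f1 f2 IH1 IH2||u].
- by rewrite !linearP /= IH1 IH2 add_lfunE scale_lfunE.
- by rewrite !linear0 zero_lfunE.
rewrite gf_comul_delta linear_sum (bigD1 s) //= big1 ?addr0 => [|s' /negPf ss].
  rewrite gf_evE !ga_deltaE eqxx mul1r.
  by rewrite -(inj_eq (mulgI s)) mulKVg.
by rewrite gf_evE !ga_deltaE eq_sym ss mul0r.
Qed.

End FunctionAlgebra.

(** * The function algebra as a color Hopf algebra *)

Section FunctionAlgebraColorHopf.
Variables (k : closedFieldType) (char0 : [pchar k] =i pred0).
Variables (G : finGroupType) (abelG : abelian [set: G]).
Variables (beta : bicharacter k G) (Gamma : finGroupType).
Variable to : groupAction [set: char_group k G] [set: Gamma].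
Local Notation e := (ga_elt k).
Local Notation F := (dual (group_alg k Gamma)).
Local Notation delta := (ga_delta k).
Local Notation gr := (dual_grading (ga_grading to)).
Local Notation mul := (gf_mul k Gamma).
Local Notation one := (gf_one k Gamma).
Local Notation comul := (gf_comul k Gamma).
Local Notation counit := (gf_counit k Gamma).
Local Notation spd := (@spanned_ga_delta k Gamma).
Local Notation op := (dual_op (ga_act to)).
Let grW : weight_grading op gr :=
  dual_weight_grading char0 abelG (ga_weight_grading to).
Let tgrW := tens_weight_grading char0 abelG grW grW.

Lemma dual_act_delta a s : op a (delta s) = delta (to s a).
Proof.
apply: eq_gf => t; rewrite dual_opE ga_actE !ga_deltaE.
by rewrite -(inj_eq (act_inj to a)) actKVin ?inE.
Qed.

Lemma gf_graded_algebra : is_graded_algebra gr mul one.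
Proof.
split.
- apply: (graded_equivariant tgrW grW) => a t.
  rewrite -!comp_lfunE; congr (fun_of_lfun _ t).
  apply: (eq_lfun_spanned (spanned_tens spd spd)) => -[s u] /=.
  rewrite !comp_lfunE /= tens_mapE !dual_act_delta !gf_mul_delta.
  by rewrite linearZ /= dual_act_delta (inj_eq (act_inj to a)).
- apply/(weight_mem grW) => a; rewrite char1 scale1r /gf_one linear_sum.
  rewrite [RHS](reindex_inj (act_inj to a)); apply: eq_bigr => s _.
  exact: dual_act_delta.
- by move=> x y z; apply: eq_gf => s; rewrite !gf_mulE mulrA.
- by move=> x; apply: eq_gf => s; rewrite gf_mulE gf_oneE mul1r.
- by move=> x; apply: eq_gf => s; rewrite gf_mulE gf_oneE mulr1.
Qed.

Lemma gf_graded_coalgebra : is_graded_coalgebra gr comul counit.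
Proof.
split.
- apply: (graded_equivariant grW tgrW) => a f.
  rewrite -!comp_lfunE; congr (fun_of_lfun _ f).
  apply: (eq_lfun_spanned spd) => u.
  rewrite !comp_lfunE dual_act_delta !gf_comul_delta linear_sum.
  rewrite (reindex_inj (act_inj to a)); apply: eq_bigr => s _ /=.
  by rewrite tens_mapE !dual_act_delta -act_autV -act_autM.
- apply: (graded_triv char0 abelG grW) => a f.
  by rewrite !gf_counitE dual_opE ga_actE act_aut1.
- apply: (eq_lfun_spanned spd) => u.
  rewrite !comp_lfunE !gf_comul_delta !linear_sum /=.
  under eq_bigr => s _ do
    rewrite tens_mapE id_lfunE gf_comul_delta tens_suml linear_sum /=.
  rewrite exchange_big; apply: eq_bigr => p _ /=.
  rewrite tens_mapE id_lfunE gf_comul_delta tens_sumr.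
  (* After [s = p * q], both sides run over the factorizations of [u] into [p], [q] and a third
     factor. *)
  rewrite (reindex_inj (mulgI p)); apply: eq_bigr => q _ /=.
  by rewrite tens_assocE mulKg invMg mulgA.
- elim/(spanned_ind spd) => [a u v IHu IHv||s].
  + by rewrite !linearP /= IHu IHv.
  + by rewrite !linear0.
  have lin (f h : F) :
      tens_lift (fun a b : F => counit a *: b) (tens f h) = counit f *: h.
    rewrite tens_liftE => // [y a u v|x a u v].
      by rewrite linearP /= scalerDl scalerA.
    by rewrite scalerDr !scalerA mulrC.
  rewrite gf_comul_delta linear_sum (bigD1 1%g) //= big1 ?addr0 => [|t /negPf t1].
    by rewrite lin gf_counitE ga_deltaE eqxx scale1r invg1 mul1g.
  by rewrite lin gf_counitE ga_deltaE eq_sym t1 scale0r.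
- elim/(spanned_ind spd) => [a u v IHu IHv||s].
  + by rewrite !linearP /= IHu IHv.
  + by rewrite !linear0.
  have lin (f h : F) :
      tens_lift (fun a b : F => counit b *: a) (tens f h) = counit h *: f.
    rewrite tens_liftE => // [y a u v|x a u v].
      by rewrite scalerDr !scalerA mulrC.
    by rewrite linearP /= scalerDl scalerA.
  rewrite gf_comul_deltaV linear_sum (bigD1 1%g) //= big1 ?addr0 => [|t /negPf t1].
    by rewrite lin gf_counitE ga_deltaE eqxx scale1r invg1 mulg1.
  by rewrite lin gf_counitE ga_deltaE eq_sym t1 scale0r.
Qed.

Lemma gf_antipode_color :
  is_color_antipode gr mul one comul counit (gf_antipode k Gamma).
Proof.
split.
- apply: (graded_equivariant grW grW) => a f; apply: eq_gf => s.
  by rewrite gf_antipodeE !dual_opE !ga_actE gf_antipodeE act_autV.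
- have invol : involutive (gf_antipode k Gamma).
    by move=> f; apply: eq_gf => s; rewrite !gf_antipodeE invgK.
  by exists (gf_antipode k Gamma).
- elim/(spanned_ind spd) => [a u v IHu IHv||u].
  + by rewrite !linearP /= IHu IHv scalerDl scalerA.
  + by rewrite !linear0 scale0r.
  rewrite gf_comul_delta /gf_one scaler_sumr !linear_sum.
  (* The antipode sends the first factor to the delta of [s^-1], whose product with that of
     [s^-1 * u] is zero unless [u = 1]; hence the inversion in the sum for [one]. *)
  rewrite [RHS](reindex_inj invg_inj); apply: eq_bigr => s _ /=.
  rewrite tens_mapE id_lfunE gf_antipode_delta gf_mul_delta gf_counitE ga_deltaE.
  by rewrite -[X in X == _]mulg1 (inj_eq (mulgI _)).
- elim/(spanned_ind spd) => [a u v IHu IHv||u].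
  + by rewrite !linearP /= IHu IHv scalerDl scalerA.
  + by rewrite !linear0 scale0r.
  rewrite gf_comul_delta /gf_one scaler_sumr !linear_sum.
  apply: eq_bigr => s _ /=.
  rewrite tens_mapE id_lfunE gf_antipode_delta gf_mul_delta gf_counitE ga_deltaE.
  rewrite invMg invgK -{1}[s]mul1g (inj_eq (mulIg _)).
  by rewrite -(inj_eq invg_inj) invgK invg1.
Qed.

Lemma gf_color_HopfP :
  is_color_Hopf_algebra beta gr mul one comul counit <->
  (forall v w, braiding beta gr gr (tens v w) = tens w v).
Proof.
split=> [[[_ _ _ comulM _ _ _] _]|flip].
  move=> f h; pose flip := tens_lift (fun x y : F => tens y x).
  have flipE x y : flip (tens x y) = tens y x.
    by rewrite /flip tens_liftE // => z a u u'; rewrite ?(tensPl, tensPr).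
  rewrite -[RHS]flipE; congr (fun_of_lfun _ _) => {f h}.
  apply: (eq_lfun_spanned (spanned_tens spd spd)) => -[v u] /=; rewrite flipE.
  apply: eq_gf_ev => x y; rewrite gf_evE !ga_deltaE.
  (* Products are pointwise, so at [x], [y] the outer factors [f] and [h] become scalars and leave
     the value of the middle tensor [z]. *)
  have ev_mid (f h : F) z :
      gf_ev k x y (tens_map mul mul
        (tens_lift (fun c b : F => tens (tens f c) (tens b h)) z)) =
      f (e x) * h (e y) * gf_ev k x y z.
    elim/(spanned_ind (spanned_tens spd spd)): z => [a z z' IHz IHz'||[s t]] /=.
    - rewrite !linearP /= IHz IHz' mulrDr; congr (_ + _); exact: mulrCA.
    - by rewrite !linear0 mulr0.
    rewrite tens_liftE => [|c a z z'|b a z z'];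
      [|by rewrite !(tensPl, tensPr)..].
    by rewrite tens_mapE !gf_evE !gf_mulE [RHS]mulrACA; congr (_ * _); apply: mulrC.
  (* With these indices, evaluation at [x], [y] keeps only the term [s = x] of the first coproduct
     and [t = y] of the second, and the middle tensor there is the braiding of the deltas of [v] and
     [u]. *)
  have := congr1 (fun c => gf_ev k x y (fun_of_lfun c
    (tens (delta (x * v)%g) (delta (u * y)%g)))) comulM.
  rewrite !comp_lfunE gf_ev_comul gf_mulE !ga_deltaE.
  rewrite (inj_eq (mulgI x)) (inj_eq (mulIg y)) mulrC => ->.
  rewrite tens_mapE gf_comul_delta tens_suml !linear_sum.
  rewrite (bigD1 x) //= big1 ?addr0 => [|s /negPf sx].
    rewrite gf_comul_deltaV tens_sumr !linear_sum (bigD1 y) //=.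
    rewrite big1 ?addr0 => [|t /negPf ty].
      rewrite middle_braidingE ev_mid !ga_deltaE !eqxx !mul1r.
      by rewrite mulKg mulgK.
    by rewrite middle_braidingE ev_mid !ga_deltaE [y == t]eq_sym ty mulr0 mul0r.
  rewrite gf_comul_deltaV tens_sumr !linear_sum big1 // => t _ /=.
  by rewrite middle_braidingE ev_mid !ga_deltaE [x == s]eq_sym sx !mul0r.
split; last by exists (gf_antipode k Gamma); apply: gf_antipode_color.
have grP := weight_is_grading char0 abelG grW.
split; [by []|exact: gf_graded_algebra|exact: gf_graded_coalgebra|..].
- apply: (eq_lfun_spanned (spanned_tens spd spd)) => -[u v] /=.
  rewrite !comp_lfunE gf_mul_delta linearZ /= gf_comul_delta scaler_sumr.
  rewrite tens_mapE !gf_comul_delta tens_suml !linear_sum; apply: eq_bigr => s _ /=.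
  (* Distinct deltas have product zero, so only the terms with [t = s] survive. *)
  rewrite tens_sumr !linear_sum (bigD1 s) //= big1 ?addr0 => [|t /negPf ts].
    rewrite (middle_flipE flip) tens_mapE !gf_mul_delta eqxx scale1r tensZr.
    by rewrite (inj_eq (mulgI _)).
  by rewrite (middle_flipE flip) tens_mapE !gf_mul_delta eq_sym ts scale0r tens0l.
- rewrite {1}/gf_one linear_sum /=.
  under eq_bigr => u _ do rewrite gf_comul_delta.
  rewrite exchange_big /= /gf_one tens_suml; apply: eq_bigr => s _.
  rewrite tens_sumr (reindex_inj (mulgI s)); apply: eq_bigr => t _ /=.
  by rewrite mulKg.
- by move=> x y; rewrite !gf_counitE gf_mulE.
- by rewrite gf_counitE gf_oneE.
Qed.

End FunctionAlgebraColorHopf.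

(** * Color groups and the support of the group algebra *)

Section ColorGroups.
Variables (k : closedFieldType) (char0 : [pchar k] =i pred0).
Variables (G : finGroupType) (abelG : abelian [set: G]).
Variables (beta : bicharacter k G) (Gamma : finGroupType).
Variable to : groupAction [set: char_group k G] [set: Gamma].
Local Notation gr := (ga_grading to).
Local Notation grW := (ga_weight_grading to).
Local Notation grP := (weight_is_grading char0 abelG grW).

Lemma chiE g h : chi beta h g = beta g h.
Proof. by rewrite /= ffunE. Qed.

(** Inverting both arguments inverts the value twice. This absorbs the inversion between the support
    of [kGamma] and that of its dual. *)
Lemma bicharV g h : beta g^-1%g h^-1%g = beta g h.
Proof.
have b1 g' : beta g' 1%g = 1.
  by apply: (mulfI (bichar_neq0 beta g' 1%g)); rewrite -bicharMr mulg1 mulr1.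
apply: (mulfI (bichar_neq0 beta g^-1%g h)); rewrite -bicharMr mulgV b1.
by rewrite -!chiE charV mulVf ?char_neq0.
Qed.

Lemma ga_elt_inj : injective (@ga_elt k Gamma).
Proof.
move=> s t /ffunP/(_ s)/eqP; rewrite !ga_eltE eqxx [t == s]eq_sym.
by have [//|_] := eqVneq s t; rewrite oner_eq0.
Qed.

(** If [a] fixes [Gamma], it fixes a nonzero vector of degree [g], on which it acts by [a g].
    Conversely, if [a] is 1 on the support, it fixes all components of each group element. *)
Lemma stab_supportP (a : char_group k G) :
  a \in 'C([set: Gamma] | to)%g <-> (forall g, g \in support_gr gr -> a g = 1).
Proof.
split=> [/astabP aS g|a1].
  rewrite inE -vpick0 => v0; have /(weight_mem grW)/(_ a) := memv_pick (gr g).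
  rewrite [X in ga_act to a X]group_alg_sum linear_sum /=.
  under eq_bigr => s _ do rewrite linearZ /= ga_actE aS ?in_setT //.
  rewrite -group_alg_sum -[LHS]scale1r => /eqP.
  by rewrite -subr_eq0 -scalerBl scaler_eq0 (negPf v0) orbF subr_eq0 eq_sym => /eqP.
apply/astabP => s _; apply: ga_elt_inj; rewrite -ga_actE.
rewrite -(sum_homogeneous_comp grP (ga_elt k s)) linear_sum.
apply: eq_bigr => g _ /=; have vg := homogeneous_comp_mem gr g (ga_elt k s).
rewrite ((weight_mem grW g _).1 vg).
have [gS|] := boolP (g \in support_gr gr); first by rewrite a1 // scale1r.
by rewrite inE negbK => /eqP g0; move: vg; rewrite g0 memv0 => /eqP->; rewrite scaler0.
Qed.

(** Needed since [char_separates] speaks of subgroups. *)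
Lemma isotropy_group_set eta : group_set (isotropy beta to eta).
Proof.
have chiM g h : chi beta (g * h)%g = (chi beta g * chi beta h)%g.
  by apply/val_inj/ffunP => x; rewrite !ffunE bicharMr.
apply/group_setP; split=> [|g h].
  (* [chi beta 1] equals its own square, hence is trivial. *)
  rewrite inE -[chi beta 1%g](mulgK (chi beta 1%g)) -chiM mulg1 mulgV.
  by rewrite act1.
by rewrite !inE chiM actMin ?inE // => /eqP-> /eqP->.
Qed.

Lemma color_groupP :
  color_group beta to <->
  (forall g h, g \in support_gr gr -> h \in support_gr gr -> beta g h = 1).
Proof.
split=> [col g h gS hS|beta1 eta].
  rewrite -chiE; apply: (stab_supportP _).1 (gS); apply/astabP => eta _.
  suff : h \in Group (isotropy_group_set eta) by rewrite inE => /eqP.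
  (* If [h] did not fix [eta], some [a] trivial on the isotropy group would have [a h != 1]; but
     such an [a] fixes [Gamma], so it is 1 on the support, which contains [h]. *)
  apply: contraT => /(char_separates char0 abelG)[a aL ah].
  have /stab_supportP/(_ h hS)/eqP := subsetP (col eta) a aL.
  by rewrite (negPf ah).
apply/subsetP => a; rewrite inE => /forall_inP aL.
apply/stab_supportP => g gS; apply/eqP/aL; rewrite inE.
(* [chi beta g] is 1 on the support, hence fixes [Gamma]; so [g] lies in every isotropy group and
   [a], trivial on these, is 1 at [g]. *)
suff /stab_supportP/astabP-> : forall h, h \in support_gr gr -> chi beta g h = 1 by [].
by move=> h hS; rewrite chiE beta1.
Qed.

End ColorGroups.

Theorem theorem4p4 (k : closedFieldType) (char0 : [pchar k] =i pred0)
    (G : finGroupType) (abelG : abelian [set: G]) (beta : bicharacter k G)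
    (Gamma : finGroupType)
    (to : groupAction [set: char_group k G] [set: Gamma]) :
  [<-> (* (i) *)
       is_color_Hopf_algebra beta (ga_grading to)
         (ga_mul k Gamma) (ga_elt k 1%g) (ga_comul k Gamma) (ga_counit k Gamma);
       (* (ii) *)
       forall g h, g \in support_gr (ga_grading to) ->
         h \in support_gr (ga_grading to) -> beta g h = 1;
       (* (iii) *)
       color_group beta to;
       (* (iv) *)
       is_color_Hopf_algebra beta (dual_grading (ga_grading to))
         (gf_mul k Gamma) (gf_one k Gamma) (gf_comul k Gamma)
         (gf_counit k Gamma)].
Proof.
have grW := ga_weight_grading to.
have grP := weight_is_grading char0 abelG grW.
have dgrP := weight_is_grading char0 abelG (dual_weight_grading char0 abelG grW).
have HopfP := ga_color_HopfP char0 abelG beta to.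
have dHopfP := gf_color_HopfP char0 abelG beta to.
tfae.
- by move/HopfP/(braiding_flipP beta grP).
- by move/(color_groupP char0 abelG).
- move/(color_groupP char0 abelG) => beta1; apply/dHopfP/(braiding_flipP beta dgrP).
  move=> g h; rewrite !(dual_support grP) => gS hS.
  by rewrite -bicharV; apply: beta1 gS hS.
- move/dHopfP/(braiding_flipP beta dgrP) => beta1.
  apply/HopfP/(braiding_flipP beta grP) => g h gS hS.
  by rewrite -bicharV beta1 // (dual_support grP) invgK.
Qed.
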